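(* Let $k\ge 0$ be an integer and let $H$ be a linear subspace of $\Omega^1(G)$ such that $\operatorname{im} d\subseteq H$ and $\dim H=|V|-1+k$. Let $\theta_1,\dots,\theta_k\in\Omega^1(G)$ be such that $H=\operatorname{im} d\oplus \mathrm{Vect}(\theta_1,\dots,\theta_k)$, and set $\vartheta=\theta_1\wedge\dots\wedge\theta_k$. Let $X$ be a determinantal random subset of $E^+$ (identified with a random subgraph of $G$) associated to $H$ in the orthonormal basis $(e^\star/\sqrt{x_e})_{e\in E^+}$ of $\Omega^1(G)$. Then $X$ belongs to $\mathcal C_k(G)$ almost surely and, for every $K\in\mathcal C_k(G)$, $$\mathbb P(X=K)=\frac{|(\vartheta,\det \mathscr Z^K)|^2\,\underline x^K}{C_k(\vartheta,\underline x)},\qquad\text{where } C_k(\vartheta,\underline x)=\sum_{K'\in\mathcal C_k(G)}|(\vartheta,\det\mathscr Z^{K'})|^2\,\underline x^{K'}.$$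
   Context: Let $\mathbb K=\mathbb R$ or $\mathbb C$. $G=(V,E)$ is a finite connected graph: $V$ is a finite set of vertices and $E$ a finite set of oriented edges, with source and target maps $s,t:E\to V$ and a fixed-point-free involution $e\mapsto e^{-1}$ of $E$ exchanging source and target. $E^+\subset E$ is a fixed subset containing exactly one element of each pair $\{e,e^{-1}\}$, with a fixed total order. Positive weights $\underline x=(x_e)_{e\in E}$ with $x_{e^{-1}}=x_e$ are given, and $\underline x^A=\prod_{e\in (A\cup A^{-1})\cap E^+}x_e$ for $A\subseteq E$. A subgraph of $G$ is a subset $S\subseteq E$ stable under $e\mapsto e^{-1}$, seen as the graph $(V,S)$ (all subgraphs are spanning); it is identified with $S\cap E^+$. $\mathcal C_k(G)$ is the set of connected subgraphs with first Betti number $k$ (equivalently, obtained by adding $k$ edges to a spanning tree). $C_1(G)$ is the free abelian group on $E$ modulo the relations $e+e^{-1}=0$; $C_0(G)$ is the free abelian group on $V$; $\partial e=t(e)-s(e)$; $Z_1(G)=\ker\partial$. For a subgraph $K$, $C_1(K)\subseteq C_1(G)$ is the subgroup generated by the edges of $K$ and $Z_1(K)=Z_1(G)\cap C_1(K)$. $\Omega^0(G)$ is the space of functions $V\to\mathbb K$, and $\Omega^1(G)=\mathrm{Hom}(C_1(G),\mathbb K)$ is the space of functions $\alpha:E\to\mathbb K$ with $\alpha(e^{-1})=-\alpha(e)$; $(e^\star)_{e\in E^+}$ is the basis of $\Omega^1(G)$ dual to $E^+$. $d:\Omega^0(G)\to\Omega^1(G)$ is $df(e)=f(t(e))-f(s(e))$.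 $\Omega^1(G)$ carries the inner product $\langle\alpha,\beta\rangle=\sum_{e\in E^+}x_e\overline{\alpha(e)}\beta(e)$. For $K\in\mathcal C_k(G)$, $\mathscr Z^K=(z_1,\dots,z_k)$ is any $\mathbb Z$-basis of the rank $k$ free group $Z_1(K)$, $\det\mathscr Z^K=z_1\wedge\dots\wedge z_k$ (well defined up to sign), and $|(\vartheta,\det\mathscr Z^K)|^2=|\det(\theta_i(z_j))_{1\le i,j\le k}|^2$. Given a finite-dimensional inner product space with an orthonormal basis indexed by a finite set $S$ and a subspace $H$, a random subset $X$ of $S$ is determinantal associated to $H$ in this basis if $\mathbb P(J\subseteq X)=\det((\Pi^H)^J_J)$ for all $J\subseteq S$, where $\Pi^H$ is the orthogonal projection on $H$ and $(\Pi^H)^J_J$ is the submatrix of its matrix in the basis with rows and columns in $J$. *)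

(* Defs.v *)
From HB Require Import structures.
From mathcomp Require Import all_boot all_order all_algebra.
From mathcomp Require Import all_classical all_reals all_analysis.
From mathcomp Require Import complex.

Set Implicit Arguments.
Unset Strict Implicit.
Unset Printing Implicit Defensive.
Import Order.TTheory GRing.Theory Num.Theory.

Local Open Scope ring_scope.

Inductive scalar_kind := RealScalars | ComplexScalars.

Definition scalar (R : realType) (b : scalar_kind) : numFieldType :=
  match b with RealScalars => R : numFieldType | ComplexScalars => R[i] end.

Definition of_real (R : realType) (b : scalar_kind) : R -> scalar R b :=
  match b return R -> scalar R b with
  | RealScalars => fun r => r
  | ComplexScalars => fun r => real_complex R r
  end.

Definition conj_scalar (R : realType) (b : scalar_kind) :
    scalar R b -> scalar R b :=
  match b return scalar R b -> scalar R b with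
  | RealScalars => fun z => z
  | ComplexScalars => fun z => conjc z
  end.

(* The absolute value with values in R; MathComp's norm on R[i] has values in
   R[i]. *)
Definition abs_scalar (R : realType) (b : scalar_kind) : scalar R b -> R :=
  match b return scalar R b -> R with
  | RealScalars => fun z => `|z|
  | ComplexScalars => fun z => ComplexField.Normc.normc z
  end.

(* Loops and multiple edges are allowed; einv_src and einv_inv give the other
   half of the exchange of sources and targets. *)
Record graph := Graph {
  vertex : finType;
  edge : finType;
  src : edge -> vertex;
  tgt : edge -> vertex;
  einv : edge -> edge;
  einvK : involutive einv;
  einv_neq : forall e, einv e != e;
  einv_src : forall e, src (einv e) = tgt e;
  epos : {set edge};
  epos_einv : forall e, (einv e \in epos) = (e \notin epos)
}.

Definition pos_edge (G : graph) : finType := {e : edge G | e \in epos G}.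

Section Subgraphs.
Variable G : graph.

Definition is_subgraph (S : {set edge G}) : bool :=
  [forall e, (e \in S) ==> (einv e \in S)].

Definition subgraph_of (A : {set pos_edge G}) : {set edge G} :=
  [set e | [exists a in A, (e == val a) || (e == einv (val a))]].

Definition adjacent (S : {set edge G}) : rel (vertex G) :=
  fun u v => [exists e in S, (src e == u) && (tgt e == v)].

Definition is_connected (S : {set edge G}) : Prop :=
  (0 < #|vertex G|)%N /\ forall u v : vertex G, connect (adjacent S) u v.

Definition chain := {ffun edge G -> int}.

(* The class of e in C_1(G): the map e |-> delta_e - delta_(e^-1) from Z^E to
   itself has for kernel the subgroup generated by the e + e^-1, hence
   identifies the quotient C_1(G) with its image, the subgroup generated by the
   edge_chain e. The coefficient of e (e in E^+) in a 1-chain c is then c e. *)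
Definition edge_chain (e : edge G) : chain :=
  [ffun f => (f == e)%:R - (f == einv e)%:R].

Definition in_C1 (S : {set edge G}) (c : chain) : Prop :=
  exists n : edge G -> int, c = \sum_(e in S) edge_chain e *~ n e.

Definition boundary (c : chain) : {ffun vertex G -> int} :=
  [ffun v => \sum_(e in epos G) c e * ((v == tgt e)%:R - (v == src e)%:R)].

Definition in_Z1 (S : {set edge G}) (c : chain) : Prop :=
  in_C1 S c /\ boundary c = 0.

Definition is_Z1_basis (S : {set edge G}) (k : nat) (z : k.-tuple chain) :
    Prop :=
  (forall j, in_Z1 S (tnth z j)) /\
  forall c, in_Z1 S c ->
    exists! n : {ffun 'I_k -> int}, c = \sum_(j < k) tnth z j *~ n j.

(* The first Betti number of a graph is the rank of the free abelian group of
   its 1-cycles. *)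
Definition has_first_betti (S : {set edge G}) (k : nat) : Prop :=
  exists z : k.-tuple chain, is_Z1_basis S z.

Definition connected_subgraphs (k : nat) : {set {set edge G}} :=
  [set S | `[< is_subgraph S /\ is_connected S /\ has_first_betti S k >]].

Definition weight_monomial (R : realType) (x : edge G -> R)
    (A : {set edge G}) : R :=
  \prod_(e in (A :|: @einv G @: A) :&: epos G) x e.

End Subgraphs.

Section Forms.
Variables (R : realType) (b : scalar_kind) (G : graph).
Local Notation K := (scalar R b).

Definition Omega0 := {ffun vertex G -> K^o}.

Definition antisym_defect (a : {ffun edge G -> K^o}) : {ffun edge G -> K^o} :=
  [ffun e => a (einv e) + a e].

Lemma antisym_defect_is_linear : linear antisym_defect.
Proof.
move=> c u v; apply/ffunP => e; rewrite !ffunE scalerDr.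
by rewrite addrACA.
Qed.

HB.instance Definition _ :=
  GRing.isLinear.Build K {ffun edge G -> K^o} {ffun edge G -> K^o} _
    antisym_defect antisym_defect_is_linear.

Definition antisym_functions : {vspace {ffun edge G -> K^o}} :=
  lker (linfun antisym_defect).

Lemma antisym_functionsP (a : {ffun edge G -> K^o}) :
  reflect (forall e, a (einv e) = - a e) (a \in antisym_functions).
Proof.
rewrite memv_ker lfunE /=; apply: (iffP eqP) => [a0 e|aN].
  by apply/eqP; rewrite -addr_eq0; move/ffunP: a0 => /(_ e); rewrite !ffunE => ->.
by apply/ffunP => e; rewrite !ffunE aN addNr.
Qed.

Definition Omega1 := subvs_of antisym_functions.

Definition form_val (a : Omega1) (e : edge G) : K := vsval a e.

Definition differential_fun (f : Omega0) : {ffun edge G -> K^o} :=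
  [ffun e => f (tgt e) - f (src e)].

Lemma differential_subproof f : differential_fun f \in antisym_functions.
Proof.
apply/antisym_functionsP => e; rewrite !ffunE opprB.
by rewrite einv_src -[in tgt (einv e)](einv_src (einv e)) einvK.
Qed.

Definition differential (f : Omega0) : Omega1 :=
  Subvs (differential_subproof f).

Lemma differential_is_linear : linear differential.
Proof.
move=> c u v; apply: val_inj; apply/ffunP => e; rewrite /= !ffunE.
by rewrite scalerBr opprD addrACA.
Qed.

HB.instance Definition _ :=
  GRing.isLinear.Build K Omega0 Omega1 _ differential differential_is_linear.

Definition dual_edge_fun (e : edge G) : {ffun edge G -> K^o} :=
  [ffun f => (f == e)%:R - (f == einv e)%:R].

Lemma dual_edge_subproof e : dual_edge_fun e \in antisym_functions.
Proof.
apply/antisym_functionsP => f; rewrite !ffunE opprB.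
by rewrite (can2_eq (@einvK G) (@einvK G)) (inj_eq (can_inj (@einvK G))).
Qed.

Definition dual_edge (e : edge G) : Omega1 := Subvs (dual_edge_subproof e).

Definition form_chain (a : Omega1) (c : chain G) : K :=
  \sum_(e in epos G) form_val a e *~ c e.

Variable x : edge G -> R.

Definition form_dot (a a' : Omega1) : K :=
  \sum_(e in epos G)
    of_real b (x e) * conj_scalar (form_val a e) * form_val a' e.

Definition orthonormal_basis (e : pos_edge G) : Omega1 :=
  (of_real b (Num.sqrt (x (val e))))^-1 *: dual_edge (val e).

(* |(theta_1 /\ ... /\ theta_k, z_1 /\ ... /\ z_k)|^2 *)
Definition wedge_pairing_sq (k : nat) (theta : k.-tuple Omega1)
    (z : k.-tuple (chain G)) : R :=
  abs_scalar (\det (\matrix_(i < k, j < k)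
    form_chain (tnth theta i) (tnth z j))) ^+ 2.

Definition partition_function (k : nat) (theta : k.-tuple Omega1)
    (Z : {set edge G} -> k.-tuple (chain G)) : R :=
  \sum_(K' in connected_subgraphs G k)
    wedge_pairing_sq theta (Z K') * weight_monomial x K'.

End Forms.

Section Determinantal.
Variables (R : realType) (b : scalar_kind).
Local Notation K := (scalar R b).
Variables (U : vectType K) (dot : U -> U -> K).

Definition is_orthogonal_projection (H : {vspace U}) (p : 'End(U)) : Prop :=
  forall v, p v \in H /\ forall h, h \in H -> dot h (v - p v) = 0.

Definition principal_submatrix (S : finType) (A : S -> S -> K)
    (J : {set S}) : 'M[K]_#|J| :=
  \matrix_(i, j) A (enum_val i) (enum_val j).

Definition is_random_subset (d : measure_display) (T : measurableType d)
    (S : finType) (X : T -> {set S}) : Prop :=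
  forall J : {set S}, measurable [set w | X w = J]%classic.

(* As the basis is orthonormal, the (e, f) entry of the matrix of p is the inner
   product of the e-th basis vector with the image of the f-th. *)
Definition is_determinantal (d : measure_display) (T : measurableType d)
    (P : probability T R) (S : finType) (basis : S -> U) (H : {vspace U})
    (X : T -> {set S}) : Prop :=
  is_random_subset X /\
  exists p : 'End(U), is_orthogonal_projection H p /\
    forall J : {set S},
      of_real b (fine (P [set w | J \subset X w]%classic)) =
      \det (principal_submatrix (fun e f => dot (basis e) (p (basis f))) J).

End Determinantal.

(* Main.v *)
(* Let h_1, ..., h_r be the basis of H made of the d delta_v, v different from a
   root, and of the theta_i. By inclusion-exclusion the probability of drawing
   exactly J is a determinant, which Sylvester's identity det (1 + U V) =
   det (1 + V U) evaluates: it vanishes unless |J| = r, and is then proportional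
   to x^J |det (h_j(e))|^2, where e ranges over J. If the subgraph J is not
   connected, the indicator of the complement of the component of the root gives
   a linear relation between the columns of this matrix; if it is connected,
   paths from the root together with a basis of Z_1(J) form a basis of C_1(J)
   over the integers, in which the matrix is block triangular with diagonal
   blocks 1 and (theta_i(z_j)). The constant is fixed by the total mass. *)
Require Import Defs.
From HB Require Import structures.
From mathcomp Require Import all_boot all_order all_algebra.
From mathcomp Require Import all_classical all_reals all_analysis.
From mathcomp Require Import complex.
From mathcomp Require Import zify.

Set Implicit Arguments.
Unset Strict Implicit.
Unset Printing Implicit Defensive.
Import Order.TTheory GRing.Theory Num.Theory.
Local Open Scope ring_scope.

(** * Determinants of matrices indexed by a finite type *)

(** Sylvester's identity. Both sides equal the determinant of [M], read off after multiplying [M] by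
    the same unipotent block matrix on the left or on the right. *)
Lemma det_1DmulC (R : comNzRingType) (m n : nat) (U : 'M[R]_(m, n))
    (V : 'M[R]_(n, m)) :
  \det (1%:M + U *m V) = \det (1%:M + V *m U).
Proof.
pose M := block_mx (1%:M : 'M[R]_m) (- U) V (1%:M : 'M[R]_n).
have E1 : M *m block_mx 1%:M U 0 1%:M = block_mx 1%:M 0 V (1%:M + V *m U).
  rewrite mulmx_block; congr block_mx;
    by rewrite ?mulmx1 ?mul1mx ?mulmx0 ?addr0 ?subrr // addrC.
have E2 : block_mx 1%:M U 0 1%:M *m M = block_mx (1%:M + U *m V) 0 V 1%:M.
  rewrite mulmx_block; congr block_mx;
    by rewrite ?mulmx1 ?mul1mx ?mul0mx ?add0r ?addNr.
have := congr1 determinant E1; have := congr1 determinant E2.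
rewrite !det_mulmx !det_lblock det_ublock !det1 ?mulr1 ?mul1r => -> ->.
by [].
Qed.

(** Factor out the swap of the two blocks. Unipotent operations make the swap block triangular with
    diagonal blocks 1 and -1, which gives its determinant. *)
Lemma det_antidiag_block (R : comNzRingType) (n : nat) (X Y : 'M[R]_n) :
  \det (block_mx 0 X Y 0) = (-1) ^+ n * (\det X * \det Y).
Proof.
have E1 : block_mx 0 X Y 0 = block_mx X 0 0 Y *m block_mx 0 1%:M 1%:M 0.
  by rewrite mulmx_block !mulmx0 !mul0mx !mulmx1 !addr0 !add0r.
have E2 : block_mx 1%:M 1%:M 0 1%:M *m block_mx 0 1%:M 1%:M 0
            *m block_mx 1%:M (- 1%:M) 0 1%:M
          = block_mx 1%:M 0 1%:M (- 1%:M) :> 'M[R]_(n + n).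
  rewrite !mulmx_block !mulmx1 !mul1mx !mulmx0 ?mul0mx ?addr0 ?add0r.
  by rewrite mul1mx addNr.
rewrite E1 det_mulmx det_ublock mulrC; congr (_ * _).
have := congr1 determinant E2.
rewrite !det_mulmx !det_ublock det_lblock !det1 !mul1r mulr1 => ->.
by rewrite -scaleN1r detZ det1 mulr1.
Qed.

Section FinIndexed.
Variables (R : comNzRingType) (E : finType).
Implicit Types (g h : E -> R) (J K L : {set E}).

Definition diag_fun g : 'M[R]_#|E| := diag_mx (\row_a g (enum_val a)).

Definition indicator_mx J : 'M[R]_#|E| := diag_fun (fun e => (e \in J)%:R).

(** The columns are the basis vectors of the [f i]: multiplication on the right extracts columns,
    and by the transpose on the left extracts rows. Minors thus become matrix products, to which
    Sylvester's identity applies. *)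
Definition selection_mx s (f : 'I_s -> E) : 'M[R]_(#|E|, s) :=
  \matrix_(a, i) (enum_val a == f i)%:R.

Lemma eq_diag_fun g h : g =1 h -> diag_fun g = diag_fun h.
Proof. by move=> gh; congr diag_mx; apply/rowP => a; rewrite !mxE gh. Qed.

Lemma diag_funM g h : diag_fun g *m diag_fun h = diag_fun (fun e => g e * h e).
Proof. by rewrite mulmx_diag; congr diag_mx; apply/rowP => a; rewrite !mxE. Qed.

Lemma diag_funD g h : diag_fun g + diag_fun h = diag_fun (fun e => g e + h e).
Proof. by rewrite -raddfD; congr diag_mx; apply/rowP => a; rewrite !mxE. Qed.

Lemma diag_funN g : - diag_fun g = diag_fun (fun e => - g e).
Proof. by rewrite -raddfN; congr diag_mx; apply/rowP => a; rewrite !mxE. Qed.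

Lemma diag_fun1 : diag_fun (fun=> 1) = 1%:M.
Proof.
by rewrite -diag_const_mx; congr diag_mx; apply/rowP => a; rewrite !mxE.
Qed.

Definition diag_funE := (diag_funM, diag_funN, diag_funD).

Lemma prod_enum_val g : \prod_(a < #|E|) g (enum_val a) = \prod_e g e.
Proof.
rewrite [RHS](reindex (@enum_val E E)) //=.
exact: onW_bij (enum_val_bij E).
Qed.

Lemma det_diag_fun g : \det (diag_fun g) = \prod_e g e.
Proof.
by rewrite det_diag -prod_enum_val; apply: eq_bigr => a _; rewrite mxE.
Qed.

Lemma prod_indicator J K :
  \prod_(e in J) (e \in K)%:R = (J \subset K)%:R :> R.
Proof.
have [/fintype.subsetP sJK|/fintype.subsetPn[e eJ eK]] := boolP (J \subset K).
  by rewrite big1 // => e /sJK ->.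
by rewrite (bigD1 e) //= (negPf eK) mul0r.
Qed.

Lemma mulmx_diag_funE n g (A : 'M[R]_(#|E|, n)) a i :
  (diag_fun g *m A) a i = g (enum_val a) * A a i.
Proof. by rewrite mul_diag_mx !mxE. Qed.

Lemma mulmx_selE n s (f : 'I_s -> E) (A : 'M[R]_(n, #|E|)) a i :
  (A *m selection_mx f) a i = A a (enum_rank (f i)).
Proof.
rewrite mxE (bigD1 (enum_rank (f i))) //= big1 ?addr0 => [|c cn].
  by rewrite mxE enum_rankK eqxx mulr1.
rewrite mxE -(inj_eq enum_rank_inj) enum_valK (negPf cn).
by rewrite mulr0.
Qed.

Lemma tr_sel_mulmxE n s (f : 'I_s -> E) (A : 'M[R]_(#|E|, n)) i a :
  ((selection_mx f)^T *m A) i a = A (enum_rank (f i)) a.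
Proof. by rewrite -[in LHS](trmxK A) -trmx_mul mxE mulmx_selE mxE. Qed.

Lemma tr_sel_mul_sel s (f : 'I_s -> E) :
  injective f -> (selection_mx f)^T *m selection_mx f = 1%:M.
Proof.
move=> fI; apply/matrixP => i j.
by rewrite tr_sel_mulmxE !mxE enum_rankK (inj_eq fI).
Qed.

Lemma sel_mul_tr_sel s (f : 'I_s -> E) J :
  injective f -> J = f @: [set: 'I_s] ->
  selection_mx f *m (selection_mx f)^T = indicator_mx J.
Proof.
move=> fI ->; apply/matrixP => a c; rewrite !mxE.
have [/imsetP[i _ ei]|nJ] := boolP (enum_val a \in _).
  rewrite (bigD1 i) //= big1 ?addr0 => [|j ji].
    rewrite !mxE ei eqxx mul1r -ei eq_sym.
    by rewrite (inj_eq enum_val_inj).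
  by rewrite !mxE ei (inj_eq fI) eq_sym (negPf ji) mul0r.
rewrite mul0rn big1 // => i _; rewrite !mxE.
have [ei|_] := eqVneq; last by rewrite mul0r.
by rewrite ei imset_f in nJ.
Qed.

(** Multilinearity in the rows, [L] being the set of rows taken from [A]. For each permutation in
    Leibniz's formula, a product of sums of two terms is expanded over the subsets. *)
Lemma det_add_rows (A B : 'M[R]_#|E|) :
  \det (A + B) =
  \sum_(L : {set E}) \det (indicator_mx L *m A + indicator_mx (~: L) *m B).
Proof.
rewrite exchange_big /=; apply: eq_bigr => s _.
rewrite -big_distrr /=; congr (_ * _).
have eE (F : 'I_#|E| -> R) : \prod_a F a = \prod_e F (enum_rank e).
  by rewrite -(prod_enum_val (F \o enum_rank)); apply: eq_bigr => a _ /=;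
     rewrite enum_valK.
rewrite eE; under eq_bigr => e _ do rewrite mxE.
rewrite bigA_distr /=; apply: eq_bigr => L _.
rewrite eE; apply: eq_bigr => e _;
  rewrite [RHS]mxE !mulmx_diag_funE enum_rankK inE.
by case: (e \in L); rewrite ?mul1r ?mul0r ?addr0 ?add0r.
Qed.

(** With P the selection matrix, the left-hand matrix is 1 + P (P^T (A - 1)); Sylvester's identity
    brings it down to size [s], where P^T P = 1. *)
Lemma det_selection s (f : 'I_s -> E) J (A : 'M[R]_#|E|) :
  injective f -> J = f @: [set: 'I_s] ->
  \det (indicator_mx J *m A + indicator_mx (~: J)) =
  \det ((selection_mx f)^T *m A *m selection_mx f).
Proof.
move=> fI defJ.
have -> : indicator_mx J *m A + indicator_mx (~: J) =
          1%:M + selection_mx f *m ((selection_mx f)^T *m (A - 1%:M)).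
  rewrite mulmxA (sel_mul_tr_sel fI defJ) mulmxBr mulmx1 addrCA; congr (_ + _).
  rewrite -diag_fun1 /indicator_mx !diag_funE; apply: eq_diag_fun => e.
  by rewrite inE; case: (e \in J); rewrite ?subrr ?subr0.
rewrite det_1DmulC mulmxBr mulmxBl mulmx1 tr_sel_mul_sel //.
by rewrite addrC subrK.
Qed.

(* For a determinantal random set of kernel [A], the determinant of this matrix
   is the probability of drawing exactly [J]. *)
Definition event_mx J (A : 'M[R]_#|E|) : 'M[R]_#|E| :=
  indicator_mx J *m A + indicator_mx (~: J) *m (1%:M - A).

Definition mobius J L : R := (J \subset L)%:R * (-1) ^+ #|L :\: J|.

(** Inclusion-exclusion in matrix form. The event matrix is D A + [indicator_mx (~: J)] with D = 1
    on [J] and -1 elsewhere; it is expanded by rows. The term of [L] has a zero row unless [L]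
    contains [J], and otherwise is a principal minor with one sign for each element of [L :\: J]. *)
Lemma det_event J (A : 'M[R]_#|E|) :
  \det (event_mx J A) =
  \sum_(L : {set E}) mobius J L *
    \det ((selection_mx (@enum_val E (pred_of_set L)))^T *m A
            *m selection_mx (@enum_val E (pred_of_set L))).
Proof.
have -> : event_mx J A =
    (indicator_mx J - indicator_mx (~: J)) *m A + indicator_mx (~: J).
  by rewrite /event_mx mulmxBr mulmx1 mulmxBl addrAC addrA.
rewrite det_add_rows; apply: eq_bigr => L _; rewrite /mobius.
have [sJL|/fintype.subsetPn[e eJ eL]] := boolP (J \subset L); last first.
  rewrite !mul0r.
  (* Multiplication by this indicator matrix erases the row of [e]; that it fixes [M] says that this
     row is zero. *)
  set M := (X in \det X); have -> : M = indicator_mx (~: [set e]) *m M.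
    rewrite /M mulmxDr !mulmxA /indicator_mx !diag_funE; congr (_ *m _ + _).
      apply: eq_diag_fun => c; rewrite !inE.
      by have [->|] := eqVneq c e; rewrite ?(negPf eL) ?mul0r ?mulr0 ?mul1r.
    apply: eq_diag_fun => c; rewrite !inE.
    by have [->|] := eqVneq c e; rewrite ?eJ ?mul0r ?mulr0 ?mul1r.
  by rewrite det_mulmx det_diag_fun (bigD1 e) //= !inE eqxx !mul0r.
rewrite mul1r -(det_selection (J := L)) /=; first last.
- apply/setP => e; apply/idP/imsetP => [eL|[i _ ->]]; last exact: enum_valP.
  by exists (enum_rank_in eL e); rewrite ?inE // enum_rankK_in.
- exact: enum_val_inj.
have -> : indicator_mx L *m ((indicator_mx J - indicator_mx (~: J)) *m A)
            + indicator_mx (~: L) *m indicator_mx (~: J) =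
          diag_fun (fun e => if e \in L :\: J then -1 else 1)
            *m (indicator_mx L *m A + indicator_mx (~: L)).
  rewrite mulmxDr !mulmxA /indicator_mx !diag_funE; congr (_ *m _ + _);
  apply: eq_diag_fun => e; rewrite !inE; have /implyP := fintype.subsetP sJL e;
  by case: (e \in J); case: (e \in L);
     rewrite //= ?(mul1r, mul0r, mulr1, mulr0, subr0, sub0r).
rewrite det_mulmx det_diag_fun; congr (_ * _).
by rewrite -big_mkcond /= prodr_const.
Qed.

(** The kernel [indicator_mx L] is that of the deterministic set [L]. Its event matrix is diagonal,
    with determinant 1 or 0 according to whether [J] equals [L], and [det_event] expands it. *)
Lemma mobius_inversion J L :
  (J == L)%:R = \sum_(K : {set E}) mobius J K * (K \subset L)%:R.
Proof.
have -> : (J == L)%:R = \det (event_mx J (indicator_mx L)).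
  rewrite /event_mx -diag_fun1 /indicator_mx !diag_funE det_diag_fun.
  have [->|/eqP nJL] := eqVneq J L.
    rewrite big1 // => e _; rewrite inE; case: (e \in L);
    by rewrite /= ?(mul1r, mul0r, mulr1, mulr0, subr0, addr0, add0r).
  have [e ne] : exists e, (e \in J) != (e \in L).
    apply/existsP; rewrite -[X in is_true X]negbK negb_exists.
    apply/forallP => eJL; apply: nJL; apply/setP => e.
    by have := eJL e; rewrite negbK => /eqP.
  rewrite (bigD1 e) //= inE; move: ne; case: (e \in L);
    case: (e \in J) => //= _;
  by rewrite ?(mul1r, mul0r, mulr1, mulr0, subr0, addr0, add0r, subrr).
rewrite det_event; apply: eq_bigr => K _; congr (_ * _).
set f := enum_val; have fI : injective f by exact: enum_val_inj.
have -> : (selection_mx f)^T *m indicator_mx L *m selection_mx f =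
          diag_mx (\row_i (f i \in L)%:R).
  apply/matrixP => i j; rewrite mulmx_selE tr_sel_mulmxE !mxE.
  by rewrite (inj_eq enum_rank_inj) (inj_eq fI) enum_rankK.
rewrite det_diag -prod_indicator [RHS]big_enum_val.
by apply: eq_bigr => i _; rewrite mxE.
Qed.

End FinIndexed.

(** * Event determinants of a projection kernel *)

Section ProjectionEvents.
Variables (E : finType) (r : nat).
Implicit Types (J : {set E}).

(* Up to the sign matrix [1 - 2 P P^T] the event matrix is [1 - [P C] [P^T; A]],
   whose determinant is that of a 2r x 2r antidiagonal block matrix. *)
Lemma det_event_projection (R : comNzRingType) (A : 'M[R]_(r, #|E|))
    (C : 'M[R]_(#|E|, r)) (f : 'I_r -> E) J :
  A *m C = 1%:M -> injective f -> J = f @: [set: 'I_r] ->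
  \det (event_mx J (C *m A)) =
  \det ((selection_mx R f)^T *m C) * \det (A *m selection_mx R f).
Proof.
move=> AC fI defJ; set P := selection_mx R f.
have PP : P^T *m P = 1%:M by exact: tr_sel_mul_sel.
have PJ : P *m P^T = indicator_mx R J by exact: sel_mul_tr_sel.
have defJc : indicator_mx R (~: J) = 1%:M - P *m P^T.
  rewrite PJ -(diag_fun1 R E) /indicator_mx !diag_funE; apply: eq_diag_fun => e.
  by rewrite inE; case: (e \in J); rewrite ?subrr ?subr0.
have -> : event_mx J (C *m A) =
   (1%:M + P *m - (P^T + P^T)) *m (1%:M + row_mx P C *m - col_mx P^T A).
  rewrite /event_mx -PJ defJc !mulmxN mul_row_col [P *m (_ + _)]mulmxDr.
  have QQ : P *m P^T *m (P *m P^T) = P *m P^T.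
    by rewrite mulmxA -[P *m P^T *m P]mulmxA PP mulmx1.
  move: (P *m P^T) (C *m A) QQ => Q T QQ.
  have QX : Q *m (1%:M - (Q + T)) = - (Q *m T).
    by rewrite mulmxBr mulmx1 mulmxDr QQ opprD addNKr.
  rewrite [RHS]mulmxDl mul1mx mulNmx [(Q + Q) *m _]mulmxDl QX mulmxBl mul1mx
    mulmxBr mulmx1.
  rewrite !opprD !opprK -!addrA [LHS]addrC -!addrA; congr (_ + _).
  exact: addrCA.
rewrite det_mulmx [X in X * _]det_1DmulC [X in _ * X]det_1DmulC mulNmx
  mulmxDl PP.
have -> : 1%:M - (1%:M + 1%:M) = - 1%:M :> 'M[R]_r by rewrite opprD addNKr.
rewrite mulNmx mul_col_row PP AC.
have -> : 1%:M - block_mx 1%:M (P^T *m C) (A *m P) 1%:M =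
          block_mx 0 (- (P^T *m C)) (- (A *m P)) 0.
  by rewrite (scalar_mx_block r r 1) opp_block_mx add_block_mx ?subrr ?sub0r.
rewrite det_antidiag_block.
have detN (M : 'M[R]_r) : \det (- M) = (-1) ^+ r * \det M.
  by rewrite -scaleN1r detZ.
rewrite !detN det1 mulr1 [X in _ * (_ * X)]mulrACA -expr2 sqrr_sign mul1r.
by rewrite mulrA -expr2 sqrr_sign mul1r.
Qed.

(** If the event matrix is invertible, its rows in [J] are independent rows of C A, so there are at
    most [r] of them. Its other rows are independent rows of 1 - C A, whose rank is at most |E| - r
    because A (1 - C A) = 0. *)
Lemma det_event_projection0 (F : fieldType) (A : 'M[F]_(r, #|E|))
    (C : 'M[F]_(#|E|, r)) J :
  A *m C = 1%:M -> #|J| != r -> \det (event_mx J (C *m A)) = 0.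
Proof.
move=> AC; apply: contraNeq; rewrite -unitfE -unitmxE => uN.
set N := event_mx _ _ in uN.
have selI K : injective (fun i : 'I_#|K| => enum_val i : E).
  exact: enum_val_inj.
have sel_ind (K L : {set E}) : K \subset L ->
    (selection_mx F (fun i : 'I_#|K| => enum_val i))^T *m indicator_mx F L =
    (selection_mx F (fun i : 'I_#|K| => enum_val i))^T.
  move=> /fintype.subsetP sKL; apply/matrixP => i a.
  rewrite tr_sel_mulmxE !mxE enum_rankK sKL ?enum_valP //.
  by rewrite -[in RHS](inj_eq enum_rank_inj) enum_valK eq_sym.
have sel_indC (K L : {set E}) : K \subset ~: L ->
    (selection_mx F (fun i : 'I_#|K| => enum_val i))^T *m indicator_mx F L = 0.
  move=> /fintype.subsetP sKL; apply/matrixP => i a.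
  rewrite tr_sel_mulmxE !mxE enum_rankK.
  have /sKL := enum_valP i; rewrite inE => /negPf ->.
  by rewrite mul0rn.
(* With P selecting [J], P^T N = P^T C A, so the identity P^T N N^-1 P of size |J| factors through
   dimension [r]. *)
have leJ : (#|J| <= r)%N.
  apply: (@mulmx1_min F _ _
    ((selection_mx F (fun i : 'I_#|J| => enum_val i))^T *m C)
    (A *m (invmx N *m selection_mx F (fun i : 'I_#|J| => enum_val i)))).
  rewrite -(tr_sel_mul_sel F (@selI J)) -[X in _ = _ *m X](mulKVmx uN) !mulmxA.
  do 2 congr (_ *m _).
  rewrite mulmxDr !mulmxA sel_ind // sel_indC ?mul0mx ?addr0 //.
  by rewrite finset.setCK.
have leJc : (#|~: J| <= \rank (1%:M - C *m A)%R)%N.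
  apply: (mulmx1_min_rank
    (M := (selection_mx F (fun i : 'I_#|~: J| => enum_val i))^T)
    (N := invmx N *m selection_mx F (fun i : 'I_#|~: J| => enum_val i))).
  rewrite -(tr_sel_mul_sel F (@selI (~: J))) -[X in _ = _ *m X](mulKVmx uN).
  rewrite !mulmxA; do 2 congr (_ *m _).
  by rewrite [RHS]mulmxDr !mulmxA sel_indC // sel_ind ?mul0mx ?add0r.
have rA : (r <= \rank A)%N.
  by apply: (mulmx1_min_rank (M := 1%:M) (N := C)); rewrite mul1mx.
have /mulmx0_rank_max : A *m (1%:M - C *m A) = 0.
  by rewrite mulmxBr mulmx1 mulmxA AC mul1mx subrr.
move=> leE; rewrite eqn_leq leJ /=.
move: leJc (leq_trans (leq_add rA (leqnn _)) leE) (cardsC J); lia.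
Qed.

End ProjectionEvents.

(** * Chains and cycles *)

Lemma connect_ind (T : finType) (e : rel T) (u : T) (P : T -> Prop) :
  P u -> (forall v w, connect e u v -> P v -> e v w -> P w) ->
  forall v, connect e u v -> P v.
Proof.
move=> Pu Pe v /connectP[p]; elim/last_ind: p v => [|p w IH] v /=.
  by move=> _ ->.
rewrite rcons_path last_rcons => /andP[ep ew] ->.
by apply: (Pe (last u p)) => //; [apply/connectP; exists p|exact: IH].
Qed.

Section Chains.
Variable G : graph.
Implicit Types (c : chain G) (a : pos_edge G) (e : edge G) (S : {set edge G}).

Lemma boundary_is_zmod_morphism : zmod_morphism (@boundary G).
Proof.
move=> c c'; apply/ffunP => v; rewrite !ffunE -sumrB; apply: eq_bigr => e _.
by rewrite !ffunE mulrBl.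
Qed.

HB.instance Definition _ := GRing.isZmodMorphism.Build (chain G)
  {ffun vertex G -> int} (@boundary G) boundary_is_zmod_morphism.

Lemma einv_notin_epos a : einv (val a) \notin epos G.
Proof. by rewrite epos_einv negbK; exact: valP. Qed.

Lemma val_neq_einv a a' : val a != einv (val a').
Proof.
by apply: contraTneq (valP a) => ->; exact: einv_notin_epos.
Qed.

Lemma edge_chain_pos a a' : edge_chain (val a) (val a') = (a' == a)%:R.
Proof. by rewrite ffunE (inj_eq val_inj) (negPf (val_neq_einv a' a)) subr0. Qed.

Lemma edge_chain_einv e : edge_chain (einv e) = - edge_chain e.
Proof. by apply/ffunP => e'; rewrite !ffunE einvK opprB. Qed.

Lemma src_tgt_einv e : src (einv e) = tgt e /\ tgt (einv e) = src e.
Proof. by split; rewrite ?einv_src // -einv_src einvK. Qed.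

Lemma pos_edgeP e : exists a, e = val a \/ e = einv (val a).
Proof.
have [ep|] := boolP (e \in epos G); first by exists (exist _ e ep); left.
by rewrite -epos_einv => ep; exists (exist _ (einv e) ep); right;
  rewrite /= einvK.
Qed.

Lemma sum_epos (M : nmodType) (F : edge G -> M) :
  \sum_(e in epos G) F e = \sum_(a : pos_edge G) F (val a).
Proof. exact: (big_sub (epos G)). Qed.

Lemma boundary_edge e v :
  boundary (edge_chain e) v = (v == tgt e)%:R - (v == src e)%:R.
Proof.
have pos a : boundary (edge_chain (val a)) v =
    (v == tgt (val a))%:R - (v == src (val a))%:R.
  rewrite ffunE sum_epos (bigD1 a) //= big1 => [|a' a'a].
    by rewrite edge_chain_pos eqxx mul1r addr0.
  by rewrite edge_chain_pos (negPf a'a) mul0r.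
have [a [->|->]] := pos_edgeP e => //.
rewrite edge_chain_einv raddfN ffunE pos opprB.
by have [-> ->] := src_tgt_einv (val a).
Qed.

Lemma sum_boundary c : \sum_v boundary c v = 0.
Proof.
have sum1 x : \sum_v (v == x)%:R = 1 :> int.
  by rewrite (bigD1 x) //= eqxx big1 ?addr0 // => v /negPf ->.
under eq_bigr do rewrite ffunE.
rewrite exchange_big /= big1 // => e _.
by rewrite -mulr_sumr sumrB !sum1 subrr mulr0.
Qed.

Lemma in_C1_0 S : in_C1 S 0.
Proof. by exists (fun=> 0); rewrite big1 // => e _; rewrite mulr0z. Qed.

Lemma in_C1_add S c c' : in_C1 S c -> in_C1 S c' -> in_C1 S (c + c').
Proof.
move=> [n ->] [n' ->]; exists (fun e => n e + n' e).
by rewrite -big_split; apply: eq_bigr => e _; rewrite mulrzDr.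
Qed.

Lemma in_C1_mulz S c m : in_C1 S c -> in_C1 S (c *~ m).
Proof.
move=> [n ->]; exists (fun e => n e * m).
by rewrite mulrz_suml; apply: eq_bigr => e _; rewrite mulrzA.
Qed.

Lemma in_C1_sum S (I : finType) (c : I -> chain G) :
  (forall i, in_C1 S (c i)) -> in_C1 S (\sum_i c i).
Proof.
by move=> Sc; elim/big_ind: _ => //; [exact: in_C1_0|exact: in_C1_add].
Qed.

Lemma in_C1_edge S e : e \in S -> in_C1 S (edge_chain e).
Proof.
move=> eS; exists (fun e' => (e' == e)%:R).
rewrite (bigD1 e) //= eqxx big1 ?addr0 ?mulr1z // => e' /andP[_ /negPf ->].
by rewrite mulr0z.
Qed.

(** The chain is the sum of the edges along a path; its boundary telescopes. *)
Lemma path_chain S u v : connect (Defs.adjacent S) u v ->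
  exists c, in_C1 S c /\
    forall w, boundary c w = (w == v)%:R - (w == u)%:R.
Proof.
move: v; apply: connect_ind.
  exists 0; split; first exact: in_C1_0.
  by move=> w; rewrite raddf0 ffunE subrr.
move=> v w _ [c [cS bc]] /exists_inP[e eS /andP[/eqP se /eqP te]].
exists (c + edge_chain e); split; first exact: in_C1_add (in_C1_edge eS).
by move=> x; rewrite raddfD ffunE bc boundary_edge se te addrC subrKA.
Qed.

Section Subgraph.
Variables (s : nat) (f : 'I_s -> pos_edge G).
Hypothesis f_inj : injective f.
Let S := subgraph_of (f @: [set: 'I_s]).

Lemma in_subgraph_ofP (A : {set pos_edge G}) e :
  reflect (exists2 a, a \in A & e = val a \/ e = einv (val a))
          (e \in subgraph_of A).
Proof.
rewrite inE; apply: (iffP exists_inP) => -[a aA].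
  by move=> /orP[]/eqP ->; exists a; auto.
by move=> [] ->; exists a; rewrite ?eqxx ?orbT.
Qed.

Lemma is_subgraph_subgraph_of (A : {set pos_edge G}) :
  is_subgraph (subgraph_of A).
Proof.
apply/forallP => e; apply/implyP => /in_subgraph_ofP[a aA].
by move=> [] ->; apply/in_subgraph_ofP; exists a; rewrite ?einvK; auto.
Qed.

Lemma adjacent_sym (A : {set edge G}) :
  is_subgraph A -> symmetric (Defs.adjacent A).
Proof.
move=> /forallP sA; apply: symmetric_from_pre => u v /exists_inP[e eA].
move=> /andP[/eqP <- /eqP <-]; apply/exists_inP; exists (einv e).
  by have /implyP := sA e; apply.
by have [-> ->] := src_tgt_einv e; rewrite !eqxx.
Qed.

Lemma subgraph_edgeP e :
  reflect (exists i, e = val (f i) \/ e = einv (val (f i))) (e \in S).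
Proof.
apply: (iffP (in_subgraph_ofP _ _)) => [[a /imsetP[i _ ->]]|[i ei]].
  by exists i.
by exists (f i); rewrite ?imset_f.
Qed.

Lemma in_C1_combination (n : 'I_s -> int) :
  in_C1 S (\sum_i edge_chain (val (f i)) *~ n i).
Proof.
apply: in_C1_sum => i; apply: in_C1_mulz; apply: in_C1_edge.
by apply/subgraph_edgeP; exists i; left.
Qed.

Lemma combination_coef (n : 'I_s -> int) j :
  (\sum_i edge_chain (val (f i)) *~ n i) (val (f j)) = n j.
Proof.
rewrite sum_ffunE (bigD1 j) //= big1 ?addr0 => [|i ij].
  by rewrite ffunMzE edge_chain_pos eqxx intz.
by rewrite ffunMzE edge_chain_pos (inj_eq f_inj) eq_sym (negPf ij) mul0rz.
Qed.

(** Both sides are additive in [c], so it suffices to treat the edges of [S], where inversion only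
    changes the sign. This replaces the redundant generators in [in_C1] by coordinates in the
    positive edges. *)
Lemma in_C1_coefE c : in_C1 S c ->
  c = \sum_i edge_chain (val (f i)) *~ c (val (f i)).
Proof.
have edgeE i : edge_chain (val (f i)) = \sum_j edge_chain (val (f j))
    *~ edge_chain (val (f i)) (val (f j)).
  rewrite (bigD1 i) //= edge_chain_pos eqxx big1 ?addr0 // => j ji.
  by rewrite edge_chain_pos (inj_eq f_inj) (negPf ji).
move=> [n ->]; set F := fun c => \sum_i edge_chain (val (f i)) *~ c (val (f i)).
have FD c1 c2 : F (c1 + c2) = F c1 + F c2.
  by rewrite /F -big_split; apply: eq_bigr => i _; rewrite ffunE mulrzDr.
have FM c1 m : F (c1 *~ m) = F c1 *~ m.
  by rewrite /F mulrz_suml; apply: eq_bigr => i _;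
    rewrite ffunMzE mulrzz mulrzA.
apply: (big_ind (fun c => c = F c)) => [|c1 c2 e1 e2|e eS].
- by rewrite /F big1 // => i _; rewrite ffunE.
- by rewrite FD -e1 -e2.
rewrite FM; congr (_ *~ _).
have /subgraph_edgeP[i [->|->]] := eS; first exact: edgeE.
rewrite edge_chain_einv -mulrN1z FM; congr (_ *~ _); exact: edgeE.
Qed.

End Subgraph.
End Chains.

(** * Paths from a root and integral bases of the 1-chains *)

Section RootedGraph.
Variables (G : graph) (root : vertex G).
Implicit Types (c : chain G) (S : {set edge G}).

(** Leaving out one vertex removes the linear relation between the coefficients of a boundary and,
    dually, the constant functions killed by [differential]. *)
Definition nonroot (i : 'I_#|predC1 root|) : vertex G := enum_val i.

Lemma nonroot_inj : injective nonroot.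
Proof. exact: enum_val_inj. Qed.

Lemma nonroot_neq i : nonroot i != root.
Proof. exact: (enum_valP i). Qed.

Lemma nonrootP v : v != root -> exists i, v = nonroot i.
Proof.
move=> vr; have {}vr : v \in predC1 root by [].
by exists (enum_rank_in vr v); rewrite /nonroot enum_rankK_in.
Qed.

(** The coefficients of a boundary sum to zero, so those away from the root determine the one at the
    root. *)
Lemma boundary_eq0 c :
  (forall i, boundary c (nonroot i) = 0) -> boundary c = 0.
Proof.
move=> c0; have c0' v : v != root -> boundary c v = 0.
  by move=> /nonrootP[i ->].
apply/ffunP => v; rewrite [RHS]ffunE; have [->|/c0' //] := eqVneq v root.
by have := sum_boundary c; rewrite (bigD1 root) //= big1 ?addr0.
Qed.

(** [T i] stands for a path from the root to [nonroot i], and the family for a section of the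
    boundary map. The coefficient at the root follows from the others. *)
Definition is_path_family S (T : 'I_#|predC1 root| -> chain G) :=
  forall i, in_C1 S (T i) /\
    forall j, boundary (T i) (nonroot j) = (j == i)%:R.

Lemma path_family_exists S :
  (forall v, connect (Defs.adjacent S) root v) -> exists T, is_path_family S T.
Proof.
move=> Sc; apply: (@fin_all_exists _ _ (fun i T => in_C1 S T /\
    forall j, boundary T (nonroot j) = (j == i)%:R)) => i.
have [T [TS bT]] := path_chain (Sc (nonroot i)); exists T; split=> // j.
by rewrite bT (inj_eq nonroot_inj) (negPf (nonroot_neq j)) subr0.
Qed.

Section Subgraph.
Variables (s k : nat) (f : 'I_s -> pos_edge G).
Hypothesis f_inj : injective f.
Let S := subgraph_of (f @: [set: 'I_s]).
Variable T : 'I_#|predC1 root| -> chain G.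
Hypothesis T_path : is_path_family S T.

Definition path_cycle (z : k.-tuple (chain G)) (j :
  'I_(#|predC1 root| + k)) : chain G :=
  match fintype.split j with inl i => T i | inr l => tnth z l end.

Definition path_cycle_mx z : 'M[int]_(s, #|predC1 root| + k) :=
  \matrix_(i, j) path_cycle z j (val (f i)).

Lemma sum_path_cycle z (n : 'I_(#|predC1 root| + k) -> int) :
  \sum_j path_cycle z j *~ n j =
  \sum_i T i *~ n (lshift k i) + \sum_l tnth z l *~ n (rshift _ l).
Proof.
rewrite big_split_ord /=; congr (_ + _); apply: eq_bigr => i _.
  by rewrite /path_cycle (unsplitK (inl i)).
by rewrite /path_cycle (unsplitK (inr i)).
Qed.

Lemma boundary_path_combination (n : 'I_#|predC1 root| -> int) j :
  boundary (\sum_i T i *~ n i) (nonroot j) = n j.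
Proof.
rewrite raddf_sum sum_ffunE (bigD1 j) //= big1 ?addr0 => [|i ij].
  by rewrite raddfMz ffunMzE (T_path j).2 eqxx intz.
by rewrite raddfMz ffunMzE (T_path i).2 eq_sym (negPf ij) mul0rz.
Qed.

(** Subtracting from [c] the paths weighted by the coefficients of its boundary leaves a cycle,
    which decomposes in [z]. *)
Lemma path_cycle_span z c : is_Z1_basis S z -> in_C1 S c ->
  exists n : 'I_(#|predC1 root| + k) -> int, c = \sum_j path_cycle z j *~ n j.
Proof.
move=> [_ zspan] cS; pose p := \sum_i T i *~ boundary c (nonroot i).
have [|n [cp _]] := zspan (c - p).
  split.
    rewrite -mulrN1z; apply/in_C1_add/in_C1_mulz/in_C1_sum => // i.
    exact/in_C1_mulz/(T_path i).1.
  apply: boundary_eq0 => i.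
  by rewrite raddfB ffunE [X in _ + X]ffunE boundary_path_combination subrr.
exists (fun j => match fintype.split j with
                 | inl i => boundary c (nonroot i) | inr l => n l end).
rewrite sum_path_cycle -[LHS](subrK p) cp addrC; congr (_ + _);
  apply: eq_bigr => i _.
  by rewrite (unsplitK (inl i)).
by rewrite (unsplitK (inr i)).
Qed.

(** The boundary kills the cycles and isolates the coefficient of each path, which therefore
    vanishes. Uniqueness of the decomposition of 0 in [z] then disposes of the cycles. *)
Lemma path_cycle_free z (n : 'I_(#|predC1 root| + k) -> int) :
  is_Z1_basis S z -> \sum_j path_cycle z j *~ n j = 0 -> n =1 fun=> 0.
Proof.
move=> [zZ zspan]; rewrite sum_path_cycle => n0.
have bz : boundary (\sum_l tnth z l *~ n (rshift _ l)) = 0.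
  by rewrite raddf_sum big1 // => l _; rewrite raddfMz /= (zZ l).2 mul0rz.
have nl i : n (lshift k i) = 0.
  have := congr1 (fun c => boundary c (nonroot i)) n0.
  by rewrite raddfD /= bz addr0 boundary_path_combination raddf0 ffunE.
have nr l : n (rshift _ l) = 0.
  have [m [_ m_uniq]] := zspan 0 (conj (in_C1_0 S) (raddf0 _)).
  have e1 := m_uniq [ffun=> 0]; have e2 := m_uniq [ffun i => n (rshift _ i)].
  have : [ffun=> 0] = [ffun i => n (rshift _ i)].
    rewrite -e1; last by rewrite big1 // => i _; rewrite ffunE mulr0z.
    rewrite -e2 // -[LHS]n0 big1 ?add0r => [|i _]; last by rewrite nl mulr0z.
    by apply: eq_bigr => i _; rewrite ffunE.
  by move=> /ffunP/(_ l); rewrite !ffunE.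
by move=> j; rewrite -(splitK j); case: (fintype.split j) => i /=;
  rewrite ?nl ?nr.
Qed.

(** The positive edges of [S] on one side, the paths and cycles on the other, are two integral bases
    of C_1(S). The two inverses are asserted with [s] and [k] unrelated, so that the cardinality of
    [S] can be deduced from them. *)
Lemma path_cycle_unimodular z : is_Z1_basis S z ->
  exists N, path_cycle_mx z *m N = 1%:M /\ N *m path_cycle_mx z = 1%:M.
Proof.
move=> zB; have eS i : in_C1 S (edge_chain (val (f i))).
  by apply: in_C1_edge; apply/subgraph_edgeP; exists i; left.
have /fin_all_exists[n nE] := fun i => path_cycle_span zB (eS i).
exists (\matrix_(j, i) n i j); split; apply/matrixP => i j; rewrite !mxE.
  have := congr1 (fun c => c (val (f i))) (nE j).
  rewrite edge_chain_pos (inj_eq f_inj) => ->; rewrite sum_ffunE.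
  by apply: eq_bigr => l _; rewrite !mxE ffunMzE mulrzz.
have wS : in_C1 S (path_cycle z j).
  rewrite /path_cycle; case: (fintype.split j) => l; first exact: (T_path l).1.
  exact: (zB.1 l).1.
(* Writing the [j]-th path or cycle in edges, and then the edges back in paths and cycles, gives a
   combination equal to that element. The difference [m] of the coefficients vanishes by
   freeness. *)
pose m l := \sum_i n i l * path_cycle z j (val (f i)) - (l == j)%:R.
have /(path_cycle_free zB)/(_ i) : \sum_l path_cycle z l *~ m l = 0.
  under eq_bigr do rewrite mulrzBr; rewrite sumrB.
  have -> : \sum_l path_cycle z l *~ (l == j)%:R = path_cycle z j.
    rewrite (bigD1 j) //= eqxx mulr1z big1 ?addr0 // => l /negPf ->.
    by rewrite mulr0z.
  apply/eqP; rewrite subr_eq0; apply/eqP.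
  rewrite [RHS](in_C1_coefE f_inj wS).
  under [RHS]eq_bigr => i' _ do rewrite nE mulrz_suml.
  rewrite exchange_big /=; apply: eq_bigr => l _.
  by rewrite mulrz_sumr; apply: eq_bigr => i' _; rewrite mulrzA.
rewrite /m => /eqP; rewrite subr_eq0 => /eqP <-.
by apply: eq_bigr => l _; rewrite !mxE.
Qed.

End Subgraph.

(* The Smith normal form of the boundary map, whose invariant factors do not
   vanish because the paths from the root provide a section. *)
Lemma path_family_betti k (f : 'I_(#|predC1 root| + k) -> pos_edge G) T :
  injective f -> is_path_family (subgraph_of (f @: [set: _])) T ->
  has_first_betti (subgraph_of (f @: [set: _])) k.
Proof.
move=> f_inj T_path; set S := subgraph_of _ in T_path *.
pose comb n : chain G := \sum_i edge_chain (val (f i)) *~ n i.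
pose coef c : 'rV[int]_(#|predC1 root| + k) := \row_i c (val (f i)).
pose M : 'M[int]_(#|predC1 root| + k, #|predC1 root|) :=
  \matrix_(i, j) boundary (edge_chain (val (f i))) (nonroot j).
have coefM c : in_C1 S c -> coef c *m M = \row_j boundary c (nonroot j).
  move=> cS; apply/rowP => j; rewrite [in RHS](in_C1_coefE f_inj cS) !mxE.
  rewrite raddf_sum sum_ffunE; apply: eq_bigr => i _.
  by rewrite !mxE raddfMz ffunMzE mulrzz mulrC.
have [L uL [Q uQ [d _ defM]]] := int_Smith_normal_form M.
set D := (\matrix_(i, j) _) in defM.
have colD n (A : 'M[int]_(n, #|predC1 root| + k)) i j :
  (A *m D) i j = A i (lshift k j) * d`_j.
  rewrite mxE (bigD1 (lshift k j)) //= mxE eqxx mulr1n big1 ?addr0 // => l lj.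
  by rewrite mxE -[j : nat]/(lshift k j :
    nat) (inj_eq val_inj) (negPf lj) mulr0.
(* The paths give a left factor carrying [M] to the identity; moving [Q] to the front shows a
   diagonal entry 1 as a multiple of the invariant factor. This also rules out the default value 0
   of [nth] when [d] is too short. *)
have d_neq0 (i : 'I_#|predC1 root|) : d`_i != 0.
  have TM : (\matrix_i coef (T i)) *m L *m D *m Q = 1%:M.
    rewrite -!mulmxA [L *m _]mulmxA -defM; apply/row_matrixP => j.
    rewrite row_mul rowK coefM; last exact: (T_path j).1.
    by apply/rowP => l; rewrite !mxE (T_path j).2 eq_sym.
  have /matrixP/(_ i i) := mulmx1C TM; rewrite mulmxA colD [RHS]mxE eqxx.
  by apply: contra_eq_neq => ->; rewrite mulr0 eq_sym oner_eq0.
have LD_ker (n : 'rV[int]_(#|predC1 root| + k)) :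
  n *m M = 0 -> n *m L = row_mx 0 (rsubmx (n *m L)).
  move=> nM; rewrite -[LHS]hsubmxK; congr row_mx.
  apply/rowP => j; rewrite [RHS]mxE [LHS]mxE.
  have /rowP/(_ j) : n *m L *m D = 0.
    by rewrite -[LHS](mulmxK uQ) -(mulmxA n) -(mulmxA n) -defM nM mul0mx.
  by rewrite colD [RHS]mxE => /eqP;
    rewrite mulf_eq0 (negPf (d_neq0 j)) orbF => /eqP.
(* As [M] = L D Q, a row vector is killed by [M] when its product with [L] vanishes in the
   coordinates where D does not. The cycles are thus the combinations of the last [k] rows of
   L^-1. *)
pose z := [tuple comb (fun i => invmx L (rshift _ l) i) | l < k].
have coef_comb n : coef (comb n) = \row_i n i.
  by apply/rowP => i; rewrite !mxE combination_coef.
have comb_coef c : in_C1 S c -> comb (coef c 0) = c.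
  move=> cS; rewrite [RHS](in_C1_coefE f_inj cS).
  by apply: eq_bigr => i _; rewrite mxE.
have coef_z (n : {ffun 'I_k -> int}) :
    coef (\sum_l tnth z l *~ n l) = row_mx 0 (\row_l n l) *m invmx L.
  apply/rowP => i; rewrite [LHS]mxE [RHS]mxE big_split_ord /=.
  rewrite [X in _ = X + _]big1 ?add0r => [|j _]; last first.
    by rewrite row_mxEl mxE mul0r.
  rewrite sum_ffunE; apply: eq_bigr => l _.
  rewrite ffunMzE tnth_mktuple combination_coef // row_mxEr mxE mulrC.
  by rewrite mulrzz.
have combS n : in_C1 S (comb n) by exact: in_C1_combination.
exists z; split=> [l|c [cS bc]].
  rewrite tnth_mktuple; split=> //; apply: boundary_eq0 => j.
  have := coefM _ (combS (invmx L (rshift #|predC1 root| l))).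
  rewrite coef_comb => /rowP/(_ j); rewrite [RHS]mxE => <-.
  have -> : \row_i invmx L (rshift _ l) i = row (rshift _ l) (invmx L).
    by apply/rowP => i; rewrite !mxE.
  rewrite -row_mul defM -mulmxA mulKmx // mxE mxE big1 // => i _.
  rewrite mxE gtn_eqF ?mulr0n ?mul0r //=.
  exact: leq_trans (ltn_ord i) (leq_addr _ _).
have cM : coef c *m M = 0.
  by rewrite coefM // bc; apply/rowP => j; rewrite !mxE ffunE.
pose m : {ffun 'I_k -> int} := [ffun l => rsubmx (coef c *m L) 0 l].
have coef_inj c1 c2 : in_C1 S c1 -> in_C1 S c2 -> coef c1 = coef c2 -> c1 = c2.
  by move=> S1 S2 e; rewrite -(comb_coef c1) // e comb_coef.
exists m; split.
  apply: coef_inj => //.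
    by apply: in_C1_sum => l; apply: in_C1_mulz; rewrite tnth_mktuple.
  rewrite coef_z -[LHS](mulmxK uL) (LD_ker _ cM); congr (row_mx _ _ *m _).
  by apply/rowP => l; rewrite [RHS]mxE ffunE.
move=> m' cm'; apply/ffunP => l; rewrite ffunE cm' coef_z mulmxKV //.
by rewrite row_mxKr mxE.
Qed.

End RootedGraph.

(** * Scalars and forms *)

Section Scalars.
Variables (R : realType) (b : scalar_kind).
Implicit Types (z : Defs.scalar R b) (r : R).

Lemma of_real_is_zmod_morphism : zmod_morphism (@of_real R b).
Proof. by case: b => //= r r'; rewrite rmorphB. Qed.

Lemma of_real_is_monoid_morphism : monoid_morphism (@of_real R b).
Proof. by case: b; split=> //= r r'; rewrite rmorphM. Qed.

HB.instance Definition _ := GRing.isZmodMorphism.Build R (Defs.scalar R b)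
  (@of_real R b) of_real_is_zmod_morphism.
HB.instance Definition _ := GRing.isMonoidMorphism.Build R (Defs.scalar R b)
  (@of_real R b) of_real_is_monoid_morphism.

Lemma conj_scalar_is_zmod_morphism : zmod_morphism (@conj_scalar R b).
Proof. by case: b => //= z z'; rewrite rmorphB. Qed.

Lemma conj_scalar_is_monoid_morphism : monoid_morphism (@conj_scalar R b).
Proof.
case: b; split=> //.
- exact: (rmorph1 (@conjc R)).
- exact: (rmorphM (@conjc R)).
Qed.

HB.instance Definition _ := GRing.isZmodMorphism.Build (Defs.scalar R b)
  (Defs.scalar R b)
  (@conj_scalar R b) conj_scalar_is_zmod_morphism.
HB.instance Definition _ := GRing.isMonoidMorphism.Build (Defs.scalar R b)
  (Defs.scalar R b)
  (@conj_scalar R b) conj_scalar_is_monoid_morphism.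

Lemma of_real_inj : injective (@of_real R b).
Proof. exact: fmorph_inj. Qed.

Lemma conj_of_real r : conj_scalar (of_real b r) = of_real b r.
Proof. by case: b => //=; exact: conjc_real. Qed.

(** The properties of squared absolute values below are deduced from this identity by injectivity of
    [of_real], which treats real and complex scalars alike. *)
Lemma mul_conj_scalar z : conj_scalar z * z = of_real b (abs_scalar z ^+ 2).
Proof.
case: b z => /= z; first by rewrite real_normK ?num_real.
case: z => x y;
  rewrite /ComplexField.Normc.normc sqr_sqrtr ?addr_ge0 ?sqr_ge0 //.
by simpc; rewrite -!expr2 [y * x]mulrC subrr.
Qed.

Lemma abs_scalar_eq0 z : (abs_scalar z ^+ 2 == 0) = (z == 0).
Proof.
rewrite -(inj_eq of_real_inj) rmorph0 -mul_conj_scalar mulf_eq0.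
by rewrite fmorph_eq0 orbb.
Qed.

Lemma abs_scalarM z z' :
  abs_scalar (z * z') ^+ 2 = abs_scalar z ^+ 2 * abs_scalar z' ^+ 2.
Proof.
apply: of_real_inj; rewrite -mul_conj_scalar [RHS]rmorphM /=.
by rewrite -!mul_conj_scalar rmorphM mulrACA.
Qed.

Lemma abs_scalar_of_real r : abs_scalar (of_real b r) ^+ 2 = r ^+ 2.
Proof.
by apply: of_real_inj; rewrite -mul_conj_scalar conj_of_real expr2 rmorphM.
Qed.

End Scalars.

Section Forms.
Variables (R : realType) (b : scalar_kind) (G : graph).
Local Notation K := (Defs.scalar R b).
Local Notation Omega := (Omega1 R b G).
Implicit Types (a : Omega) (c : chain G).

Lemma form_valZ t a e : form_val (t *: a) e = t * form_val a e.
Proof. by rewrite /form_val linearZ ffunE. Qed.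

Lemma form_val_sum (I : finType) (F : I -> Omega) e :
  form_val (\sum_i F i) e = \sum_i form_val (F i) e.
Proof. by rewrite /form_val linear_sum sum_ffunE. Qed.

Lemma form_val_einv a e : form_val a (einv e) = - form_val a e.
Proof. exact/antisym_functionsP/(valP a). Qed.

Lemma form_eqP a a' :
  (forall e : pos_edge G, form_val a (val e) = form_val a' (val e)) -> a = a'.
Proof.
move=> aa'; apply: val_inj; apply/ffunP => e.
rewrite -[LHS]/(form_val a e) -[RHS]/(form_val a' e).
by have [e' [->|->]] := pos_edgeP e; rewrite ?form_val_einv aa'.
Qed.

Lemma form_val_differential (g : Omega0 R b G) e :
  form_val (differential g) e = g (tgt e) - g (src e).
Proof. by rewrite /form_val /= ffunE. Qed.

Lemma form_chain_is_zmod_morphism a : zmod_morphism (form_chain a).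
Proof.
move=> c c'; rewrite /form_chain -sumrB; apply: eq_bigr => e _.
by rewrite !ffunE mulrzBr.
Qed.

HB.instance Definition _ a := GRing.isZmodMorphism.Build (chain G) K
  (form_chain a) (form_chain_is_zmod_morphism a).

Lemma form_chain_edge a (e : pos_edge G) :
  form_chain a (edge_chain (val e)) = form_val a (val e).
Proof.
rewrite /form_chain sum_epos (bigD1 e) //= big1 => [|e' e'e].
  by rewrite edge_chain_pos eqxx addr0.
by rewrite edge_chain_pos (negPf e'e) mulr0z.
Qed.

(** Discrete Stokes formula: [differential] is the transpose of [boundary], by exchanging the sums
    over edges and vertices. *)
Lemma form_chain_differential (g : Omega0 R b G) c :
  form_chain (differential g) c = \sum_v g v *~ boundary c v.
Proof.
have pick v : g v = \sum_u g u *~ (u == v)%:R.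
  by rewrite (bigD1 v) //= eqxx big1 ?addr0 // => u /negPf ->; rewrite mulr0z.
rewrite /form_chain.
under [RHS]eq_bigr => v _ do rewrite ffunE mulrz_sumr.
rewrite exchange_big /=; apply: eq_bigr => e _.
rewrite form_val_differential [g (tgt e)]pick [g (src e)]pick -sumrB mulrz_suml.
apply: eq_bigr => v _; rewrite -mulrzBr -mulrzA; congr (_ *~ _).
by rewrite mulrC.
Qed.

Variable root : vertex G.

Definition vertex_form (i : 'I_#|predC1 root|) : Omega :=
  differential [ffun v => (v == nonroot i)%:R : K^o].

Lemma differential_vertex_forms (g : Omega0 R b G) : g root = 0 ->
  differential g = \sum_i g (nonroot i) *: vertex_form i.
Proof.
move=> g0; have gE v : g v = \sum_i g (nonroot i) * (v == @nonroot _ root i)%:R.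
  have [vr|/nonrootP[i ->]] := eqVneq v root.
    rewrite vr g0 big1 // => i _; rewrite eq_sym (negPf (nonroot_neq i)).
    exact: mulr0.
  rewrite (bigD1 i) //= eqxx big1 ?addr0 => [|j ji];
    first by rewrite [RHS]mulr1.
  by rewrite (inj_eq (@nonroot_inj _ _)) eq_sym (negPf ji); exact: mulr0.
apply: form_eqP => e; rewrite form_val_sum form_val_differential !gE -sumrB.
apply: eq_bigr => i _.
by rewrite form_valZ form_val_differential !ffunE mulrBr.
Qed.

(** Stokes' formula for the indicator function of a vertex. The vertex forms are therefore dual to
    any path family and vanish on cycles. *)
Lemma vertex_form_chain i c :
  form_chain (vertex_form i) c = (boundary c (nonroot i))%:~R.
Proof.
rewrite form_chain_differential (bigD1 (nonroot i)) //= ffunE eqxx.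
by rewrite big1 ?addr0 // => v /negPf vi; rewrite ffunE vi mul0rz.
Qed.

Lemma im_d_vertex_forms (g : Omega0 R b G) :
  exists n : 'I_#|predC1 root| -> K,
    differential g = \sum_i n i *: vertex_form i.
Proof.
(* Subtracting a constant does not change the differential and makes the function vanish at the
   root. *)
pose g' : Omega0 R b G := [ffun v => g v - g root].
exists (fun i => g' (nonroot i)); rewrite -differential_vertex_forms.
  by apply: val_inj; apply/ffunP => e; rewrite !ffunE opprB addrA subrK.
by rewrite ffunE subrr.
Qed.

Section Family.
Variables (k : nat) (theta : k.-tuple Omega).

Definition vertex_theta (j : 'I_(#|predC1 root| + k)) : Omega :=
  match fintype.split j with
  | inl i => vertex_form i
  | inr l => tnth theta l
  end.

(** The family has exactly as many vectors as the dimension of [H] in the theorem, so this inclusion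
    makes it a basis of [H], its freeness coming from the count. *)
Lemma vertex_theta_span :
  (limg (linfun (@differential R b G)) + <<theta>> <=
   <<[tuple vertex_theta j | j < #|predC1 root| + k]>>)%VS.
Proof.
have in_span j : vertex_theta j \in
    <<[tuple vertex_theta j | j < #|predC1 root| + k]>>%VS.
  by apply: memv_span; apply/tnthP; exists j; rewrite tnth_mktuple.
rewrite subv_add; apply/andP; split; apply/subvP => a.
  move=> /memv_imgP[g _ ->]; rewrite lfunE /=.
  have [n ->] := im_d_vertex_forms g.
  apply: rpred_sum => i _; apply: rpredZ.
  by have := in_span (lshift k i); rewrite /vertex_theta (unsplitK (inl i)).
apply/subvP/span_subvP => _ /tnthP[l ->].
by have := in_span (rshift _ l); rewrite /vertex_theta (unsplitK (inr l)).
Qed.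

Section Minor.
Variable f : 'I_(#|predC1 root| + k) -> pos_edge G.
Hypothesis f_inj : injective f.
Let S := subgraph_of (f @: [set: 'I_(#|predC1 root| + k)]).

Definition form_minor : 'M[K]_(#|predC1 root| + k) :=
  \matrix_(i, j) form_val (vertex_theta j) (val (f i)).

(* The paths from the root and the cycles form a basis of C_1(S) over the
   integers, so passing from the edges to them costs a determinant 1 or -1; in
   the new basis the matrix is block triangular. *)
Lemma abs_det_form_minor (z : k.-tuple (chain G)) :
  is_connected S -> is_Z1_basis S z ->
  abs_scalar (\det form_minor) ^+ 2 = wedge_pairing_sq theta z.
Proof.
move=> [_ conn] zB; have [T T_path] := path_family_exists (conn root).
have [N [WN _]] := path_cycle_unimodular f_inj T_path zB.
set W := path_cycle_mx f T z in WN.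
have coefW a c : in_C1 S c ->
    form_chain a c = \sum_i form_val a (val (f i)) *~ c (val (f i)).
  move=> cS; rewrite {1}(in_C1_coefE f_inj cS) raddf_sum.
  by apply: eq_bigr => i _; rewrite raddfMz /= form_chain_edge.
have WB : (map_mx intr W)^T *m form_minor =
    block_mx 1%:M (\matrix_(i, l) form_chain (tnth theta l) (T i)) 0
      (\matrix_(i, l) form_chain (tnth theta i) (tnth z l))^T.
  have entry j j' : ((map_mx intr W)^T *m form_minor) j j' =
      form_chain (vertex_theta j') (path_cycle T z j).
    rewrite coefW.
      by rewrite mxE; apply: eq_bigr => i _; rewrite !mxE mulrC mulrzr.
    rewrite /path_cycle; case: (fintype.split j) => l;
      first exact: (T_path l).1.
    exact: (zB.1 l).1.
  rewrite -[LHS]submxK; congr block_mx; apply/matrixP => i j;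
    rewrite mxE [LHS]mxE [LHS]entry /vertex_theta /path_cycle
      ?(unsplitK (inl i)) ?(unsplitK (inr i)) ?(unsplitK (inl j))
      ?(unsplitK (inr j)) ?vertex_form_chain !mxE //.
    by rewrite (T_path i).2 eq_sym; case: (_ == _).
  by rewrite (zB.1 i).2 ffunE.
have := congr1 determinant WB.
rewrite det_mulmx det_ublock det1 mul1r !det_tr det_map_mx => detW.
have detWN : \det N * \det W = 1 by rewrite mulrC -det_mulmx WN det1.
have sqrW : \det W ^+ 2 = 1.
  by have /orP[/eqP ->|/eqP ->] := intUnitRing.unitzPl detWN;
    rewrite ?sqrrN expr1n.
rewrite /wedge_pairing_sq -detW abs_scalarM -[LHS]mul1r; congr (_ * _).
by rewrite /= -(rmorph_int (@of_real R b)) /= abs_scalar_of_real -rmorphXn /=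
  sqrW.
Qed.

(** If some vertex cannot be reached from the root, the indicator [g] of such vertices has a
    differential vanishing on [S], and its values give a nonzero vector killed by the minor. For a
    connected [S], the number |V| - 1 + k of its positive edges forces the Betti number. *)
Lemma form_minor_connected :
  \det form_minor != 0 -> S \in connected_subgraphs G k.
Proof.
move=> detB; have sS : is_subgraph S by exact: is_subgraph_subgraph_of.
have conn v : connect (Defs.adjacent S) root v.
  pose g : Omega0 R b G :=
    [ffun v => (~~ connect (Defs.adjacent S) root v)%:R : K^o].
  have g_root : g root = 0 by rewrite ffunE connect0.
  (* The coordinates of [differential g] in the vertex forms, completed by 0 along [theta]. *)
  pose u : 'cV[K]_(#|predC1 root| + k) := col_mx (\col_i g (nonroot i)) 0.
  have Bu : form_minor *m u = 0.
    apply/matrixP => i j; rewrite mxE big_split_ord /= [RHS]mxE.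
    rewrite [X in _ + X]big1 ?addr0 => [|l _];
      last by rewrite col_mxEd [X in _ * X]mxE mulr0.
    have : form_val (differential g) (val (f i)) = 0.
      rewrite form_val_differential !ffunE.
      suff -> : connect (Defs.adjacent S) root (tgt (val (f i))) =
                connect (Defs.adjacent S) root (src (val (f i))).
        exact: subrr.
      apply/esym/same_connect_r; first exact/sym_connect_sym/adjacent_sym.
      apply/connect1/exists_inP; exists (val (f i)); rewrite ?eqxx //.
      by apply/subgraph_edgeP; exists i; left.
    rewrite (differential_vertex_forms g_root) form_val_sum => gE;
      rewrite -[RHS]gE.
    apply: eq_bigr => l _; rewrite form_valZ mulrC col_mxEu !mxE.
    by rewrite /vertex_theta (unsplitK (inl l)).
  have u0 : u = 0.
    have uB : form_minor \in unitmx by rewrite unitmxE unitfE.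
    by rewrite -[LHS](mulKmx uB) Bu mulmx0.
  have [->|/nonrootP[i ->]] := eqVneq v root; first exact: connect0.
  have /matrixP/(_ (lshift k i) 0) := u0.
  rewrite col_mxEu !mxE ffunE; case: connect => //= /eqP.
  by rewrite oner_eq0.
rewrite inE; apply/asboolP; split=> //; split.
  split=> [|v w]; first by apply/card_gt0P; exists root.
  apply: connect_trans (conn w); rewrite sym_connect_sym //.
  exact: adjacent_sym.
have [T T_path] := path_family_exists conn.
exact: path_family_betti T_path.
Qed.

End Minor.
End Family.
End Forms.

Lemma weight_monomial_subgraph (R : realType) (G : graph) (x : edge G -> R)
    (s : nat) (f : 'I_s -> pos_edge G) :
  injective f ->
  weight_monomial x (subgraph_of (f @: [set: 'I_s])) = \prod_i x (val (f i)).
Proof.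
move=> f_inj; rewrite /weight_monomial.
have -> : (subgraph_of (f @: [set: 'I_s]) :|:
    @einv G @: subgraph_of (f @: [set: 'I_s])) :&: epos G =
    (fun i => val (f i)) @: [set: 'I_s].
  apply/setP => e; rewrite !inE; apply/andP/imsetP => [[eS e_pos]|[i _ ->]].
    have eS' : e \in subgraph_of (f @: [set: 'I_s]).
      case/orP: eS => [eS|/imsetP[e' e'S ->]]; first by rewrite inE.
      have /forallP/(_ e')/implyP := is_subgraph_subgraph_of (f @: [set: 'I_s]).
      exact.
    have /subgraph_edgeP[i [ei|ei]] := eS'; first by exists i.
    by rewrite ei (negPf (einv_notin_epos _)) in e_pos.
  split; last exact: valP.
  apply/orP; left; have : val (f i) \in subgraph_of (f @: [set: 'I_s]).
    by apply/subgraph_edgeP; exists i; left.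
  by rewrite inE.
rewrite big_imset /= => [|i j _ _ /val_inj/f_inj //].
by apply: eq_bigl => i; rewrite inE.
Qed.

(** * The kernel of the determinantal process *)

Section Kernel.
Variables (R : realType) (b : scalar_kind) (G : graph).
Variables (x : edge G -> R) (x_gt0 : forall e, 0 < x e).
Local Notation K := (Defs.scalar R b).
Local Notation Omega := (Omega1 R b G).
Local Notation dot := (@form_dot R b G x).
Local Notation onb := (@orthonormal_basis R b G x).

Lemma form_dot_sumr (I : finType) a (t : I -> K) (F : I -> Omega) :
  dot a (\sum_i t i *: F i) = \sum_i t i * dot a (F i).
Proof.
rewrite /form_dot.
under [RHS]eq_bigr => i _ do rewrite big_distrr /=.
rewrite exchange_big; apply: eq_bigr => e _; rewrite form_val_sum big_distrr /=.
by apply: eq_bigr => i _; rewrite form_valZ mulrCA.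
Qed.

Lemma form_dotBr a a1 a2 : dot a (a1 - a2) = dot a a1 - dot a a2.
Proof.
rewrite /form_dot -sumrB; apply: eq_bigr => e _.
by rewrite -mulrBr /form_val linearB /= !ffunE.
Qed.

Lemma form_val_onb (e e' : pos_edge G) :
  form_val (onb e) (val e') =
  (of_real b (Num.sqrt (x (val e))))^-1 * (e' == e)%:R.
Proof.
rewrite /orthonormal_basis form_valZ /form_val /= ffunE.
by rewrite (inj_eq val_inj) (negPf (val_neq_einv e' e)) subr0.
Qed.

Lemma form_dot_onb e a :
  dot (onb e) a = of_real b (Num.sqrt (x (val e))) * form_val a (val e).
Proof.
rewrite /form_dot sum_epos (bigD1 e) //= big1 ?addr0 => [|e' e'e]; last first.
  by rewrite form_val_onb (negPf e'e) mulr0 rmorph0 mulr0 mul0r.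
rewrite form_val_onb eqxx mulr1 fmorphV /= conj_of_real; congr (_ * _).
rewrite -{1}(sqr_sqrtr (ltW (x_gt0 (val e)))) rmorphXn /= expr2 mulfK //.
by rewrite fmorph_eq0 gt_eqF // sqrtr_gt0.
Qed.

Lemma form_dot_definite a : dot a a = 0 -> a = 0.
Proof.
rewrite /form_dot sum_epos.
under eq_bigr => e _ do rewrite -mulrA mul_conj_scalar -rmorphM.
rewrite -rmorph_sum /= => /eqP; rewrite fmorph_eq0 psumr_eq0; last first.
  by move=> e _; rewrite mulr_ge0 ?sqr_ge0 // ltW.
move=> /allP a0; apply: form_eqP => e.
have /a0 /= : e \in index_enum (pos_edge G) by exact: mem_index_enum.
by rewrite mulf_eq0 gt_eqF //= abs_scalar_eq0 => /eqP ->;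
  rewrite /form_val ffunE.
Qed.

(** The vector h - p h lies in [H] and is orthogonal to [H], hence to itself. *)
Lemma orthogonal_projection_id (H : {vspace Omega}) p h :
  is_orthogonal_projection dot H p -> h \in H -> p h = h.
Proof.
move=> pH hH; have [phH orth] := pH h.
by apply/esym/eqP; rewrite -subr_eq0; apply/eqP/form_dot_definite/orth/rpredB.
Qed.

Lemma onb_expansion a : a = \sum_e dot (onb e) a *: onb e.
Proof.
apply: form_eqP => e; rewrite form_val_sum (bigD1 e) //= big1 ?addr0;
  last first.
  by move=> e' e'e; rewrite form_valZ form_val_onb eq_sym (negPf e'e) !mulr0.
rewrite form_valZ form_val_onb form_dot_onb eqxx mulr1 mulrAC mulfV ?mul1r //.
by rewrite fmorph_eq0 gt_eqF // sqrtr_gt0.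
Qed.

Definition kernel_mx (p : 'End(Omega)) : 'M[K]_#|pos_edge G| :=
  \matrix_(e, e') dot (onb (enum_val e)) (p (onb (enum_val e'))).

Variables (H : {vspace Omega}) (p : 'End(Omega)).
Hypothesis p_orth : is_orthogonal_projection dot H p.
Variables (r : nat) (h : 'I_r -> Omega).
Hypothesis h_basis : basis_of H [tuple h j | j < r].

Let hE (j : 'I_r) : [tuple h j | j < r]`_j = h j.
Proof. by rewrite -tnth_nth tnth_mktuple. Qed.

(* The kernel is [C A], with [C] the coordinates of the basis [h] of [H] and [A]
   the coordinates, in [h], of the projections of the orthonormal basis;
   orthogonality makes [A] proportional, on the left, to the adjoint of [C]. *)
Lemma det_event_kernel :
  (forall J : {set pos_edge G}, #|J| != r ->
    \det (event_mx J (kernel_mx p)) = 0) /\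
  exists t : K, forall (J : {set pos_edge G}) (f : 'I_r -> pos_edge G),
    injective f -> J = f @: [set: 'I_r] ->
    \det (event_mx J (kernel_mx p)) =
    t * of_real b ((\prod_i x (val (f i))) *
      abs_scalar (\det (\matrix_(i, j) form_val (h j) (val (f i)))) ^+ 2).
Proof.
pose C : 'M[K]_(#|pos_edge G|, r) :=
  \matrix_(e, j) dot (onb (enum_val e)) (h j).
pose coef e j := coord [tuple h j | j < r] j (p (onb e)).
have p_onb e : p (onb e) = \sum_j coef e j *: h j.
  rewrite [LHS](coord_basis h_basis (p_orth _).1).
  by apply: eq_bigr => j _; rewrite hE.
pose A : 'M[K]_(r, #|pos_edge G|) := \matrix_(j, e) coef (enum_val e) j.
have defK : kernel_mx p = C *m A.
  apply/matrixP => e e'; rewrite !mxE p_onb form_dot_sumr.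
  by apply: eq_bigr => j _; rewrite !mxE mulrC.
have hH j : h j \in H.
  by rewrite -hE; apply: (basis_mem h_basis); rewrite mem_nth // size_tuple.
(* A C is the matrix, in the basis [h], of the restriction of [p] to [H], which is the identity. *)
have AC : A *m C = 1%:M.
  have h_free := basis_free h_basis.
  apply/matrixP => i j.
  have : h j = \sum_i (A *m C) i j *: [tuple h j | j < r]`_i.
    rewrite -{1}(orthogonal_projection_id p_orth (hH j)).
    rewrite {1}(onb_expansion (h j)) linear_sum.
    under eq_bigr => e _ do rewrite linearZ /= p_onb scaler_sumr.
    rewrite exchange_big /=; apply: eq_bigr => l _; rewrite mxE scaler_suml hE.
    rewrite (reindex (@enum_val _ (pos_edge G))) /=; last first.
      exact: onW_bij (enum_val_bij _).
    by apply: eq_bigr => e _; rewrite !mxE scalerA mulrC.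
  move=> /(congr1 (coord [tuple h j | j < r] i)); rewrite coord_sum_free //.
  by move=> <-; rewrite -{1}(hE j) coord_free // mxE eq_sym.
(* The Gram matrix of [h]. The relation C^* = Gm A below holds because a vector and its projection
   have the same inner products with each [h j]. *)
pose Gm : 'M[K]_r := \matrix_(i, j) dot (h i) (h j).
have adjC : (map_mx (@conj_scalar R b) C)^T = Gm *m A.
  apply/matrixP => j e; rewrite !mxE.
  have -> : conj_scalar (dot (onb (enum_val e)) (h j)) =
      dot (h j) (onb (enum_val e)).
    rewrite form_dot_onb rmorphM /= conj_of_real.
    rewrite /form_dot sum_epos (bigD1 (enum_val e)) //= big1 ?addr0.
      rewrite form_val_onb eqxx mulr1.
      rewrite -[in RHS](sqr_sqrtr (ltW (x_gt0 (val (enum_val e))))) rmorphXn /=.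
      rewrite sqr_sqrtr ?ltW // mulrAC expr2 mulfK //.
      by rewrite fmorph_eq0 gt_eqF // sqrtr_gt0.
    by move=> e' e'e; rewrite form_val_onb (negPf e'e) !mulr0.
  have [_ orth] := p_orth (onb (enum_val e)).
  have /eqP := orth _ (hH j); rewrite form_dotBr subr_eq0 => /eqP ->.
  rewrite p_onb form_dot_sumr; apply: eq_bigr => i _.
  by rewrite !mxE mulrC.
(* Gm A A^* = C^* A^* = (A C)^* = 1. *)
have Gm_unit : \det Gm != 0.
  have : Gm *m (A *m (map_mx (@conj_scalar R b) A)^T) = 1%:M.
    by rewrite mulmxA -adjC -trmx_mul -map_mxM AC map_mx1 trmx1.
  move=> /(congr1 determinant); rewrite det_mulmx det1.
  by apply: contra_eq_neq => ->; rewrite mul0r eq_sym oner_eq0.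
split=> [J Jr|]; first by rewrite defK det_event_projection0.
(* By C^* = Gm A, the second minor in [det_event_projection] is the conjugate of the first divided
   by this determinant, so their product is a squared absolute value up to a constant independent of
   [J]. *)
exists (\det Gm)^-1 => J f f_inj defJ.
rewrite defK (det_event_projection AC f_inj defJ).
set P := selection_mx K f.
have -> : \det (A *m P) = (\det Gm)^-1 * conj_scalar (\det (P^T *m C)).
  apply: (mulfI Gm_unit); rewrite mulVKf // -det_mulmx mulmxA -adjC.
  rewrite -det_map_mx -[RHS]det_tr; congr (\det _).
  apply/matrixP => i j; rewrite mulmx_selE [RHS]mxE [RHS]mxE tr_sel_mulmxE.
  by rewrite !mxE.
rewrite mulrCA; congr (_ * _); rewrite mulrC mul_conj_scalar;
  congr (of_real b _).
have -> : P^T *m C = diag_mx (\row_i of_real b (Num.sqrt (x (val (f i))))) *m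
    (\matrix_(i, j) form_val (h j) (val (f i))).
  apply/matrixP => i j; rewrite tr_sel_mulmxE mul_diag_mx !mxE.
  by rewrite enum_rankK form_dot_onb.
rewrite det_mulmx abs_scalarM det_diag; congr (_ * _).
under eq_bigr => i _ do rewrite mxE.
rewrite -rmorph_prod /= abs_scalar_of_real -prodrXl; apply: eq_bigr => i _.
by rewrite sqr_sqrtr // ltW.
Qed.

End Kernel.

(** * The law of the random subgraph *)

Section RandomSubset.
Variables (R : realType) (d : measure_display) (T : measurableType d).
Variables (P : probability T R) (S : finType) (X : T -> {set S}).
Hypothesis X_meas : is_random_subset X.

Definition subset_law (J : {set S}) : R := fine (P [set w | X w = J]%classic).

Lemma probability_pred (Q : pred {set S}) :
  P [set w | Q (X w)]%classic = (\sum_(J | Q J) subset_law J)%:E.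
Proof.
have -> : [set w | Q (X w)]%classic =
    (\bigcup_(J in [set` Q]) [set w | X w = J])%classic.
  apply/seteqP; split=> w /=; first by move=> Qw; exists (X w).
  by move=> [J /= QJ XJ]; rewrite XJ.
have X_triv : trivIset [set` Q] (fun J => [set w | X w = J]%classic).
  by move=> J J' _ _ [w /= [<- <-]].
rewrite measure_fin_bigcup //=.
rewrite -(@bigfs _ _ _ _ (index_enum {set S})) ?index_enum_uniq //; last first.
  by move=> J _; rewrite mem_index_enum.
rewrite -sumEFin; apply: eq_bigr => J _.
by rewrite fineK // fin_num_measure //; exact: X_meas.
Qed.

Lemma sum_subset_law : \sum_J subset_law J = 1.
Proof.
have := probability_pred predT.
have -> : [set w | predT (X w)]%classic = setT by apply/seteqP.
by rewrite probability_setT => -[].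
Qed.

(** Inclusion-exclusion: the indicator of [J == L] is expanded by [mobius_inversion] under the sum
    over the law, and the sums are exchanged. *)
Lemma subset_law_mobius J : subset_law J =
  \sum_(L : {set S}) mobius R J L * fine (P [set w | L \subset X w]%classic).
Proof.
have -> : subset_law J = \sum_L (J == L)%:R * subset_law L.
  rewrite (bigD1 J) //= eqxx mul1r big1 ?addr0 // => L.
  by rewrite eq_sym => /negPf ->; rewrite mul0r.
under eq_bigr => L _ do rewrite mobius_inversion big_distrl /=.
rewrite exchange_big /=; apply: eq_bigr => L _.
rewrite (probability_pred (fun K => L \subset K)) /= big_distrr
  [RHS]big_mkcond /=.
by apply: eq_bigr => K _; rewrite -mulrA; case: (_ \subset _);
  rewrite ?mul1r ?mul0r ?mulr0.
Qed.

End RandomSubset.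

(** The inclusion-exclusion sums for the law and for the event determinant carry the same signs, and
    their terms agree by the definition of a determinantal set. *)
Lemma subset_law_determinantal (R : realType) (b : scalar_kind) (G : graph)
    (x : edge G -> R) (H : {vspace Omega1 R b G}) (d : measure_display)
    (T : measurableType d) (P : probability T R) (X : T -> {set pos_edge G}) :
  is_determinantal (@form_dot R b G x) P (@orthonormal_basis R b G x) H X ->
  exists2 p, is_orthogonal_projection (@form_dot R b G x) H p &
    forall J, of_real b (subset_law P X J) = \det (event_mx J (kernel_mx x p)).
Proof.
move=> [X_meas [p [p_orth p_det]]]; exists p => // J.
rewrite (subset_law_mobius P X_meas) rmorph_sum det_event;
  apply: eq_bigr => L _.
rewrite rmorphM /= p_det /mobius; congr (_ * _).
  by rewrite rmorphM rmorph_nat rmorph_sign.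
congr determinant.
apply/matrixP => i j; rewrite mulmx_selE tr_sel_mulmxE !mxE.
by rewrite !enum_rankK.
Qed.

Lemma imset_enumeration (S : finType) (J : {set S}) (r : nat) :
  #|J| = r -> exists2 f : 'I_r -> S, injective f & J = f @: [set: 'I_r].
Proof.
move=> <-; exists (fun i : 'I_#|J| => enum_val i); first exact: enum_val_inj.
apply/setP => e; apply/idP/imsetP => [eJ|[i _ ->]]; last exact: enum_valP.
by exists (enum_rank_in eJ e); rewrite ?inE // enum_rankK_in.
Qed.

Lemma subgraph_of_inj (G : graph) : injective (@subgraph_of G).
Proof.
have mem_val (A : {set pos_edge G}) a : (val a \in subgraph_of A) = (a \in A).
  apply/in_subgraph_ofP/idP => [[a' a'A []]|aA]; last by exists a; auto.
    by move=> /val_inj ->.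
  by move=> /eqP; rewrite (negPf (val_neq_einv _ _)).
by move=> A A' AA'; apply/setP => a; rewrite -!mem_val AA'.
Qed.

Lemma subgraph_of_surj (G : graph) (S : {set edge G}) :
  is_subgraph S -> S = subgraph_of [set a | val a \in S].
Proof.
move=> /forallP sS; apply/setP => e.
apply/idP/in_subgraph_ofP => [eS|[a]].
  have [a [ea|ea]] := pos_edgeP e; exists a; auto; rewrite inE.
    by rewrite -ea.
  by have /implyP/(_ eS) := sS e; rewrite ea einvK.
by rewrite inE => aS [] -> //; have /implyP := sS (val a); apply.
Qed.

(** The change of basis between edges and paths with cycles has inverses on both sides, so it is a
    square matrix. *)
Lemma card_connected_subgraph (G : graph) (root : vertex G) (k : nat)
    (J : {set pos_edge G}) :
  subgraph_of J \in connected_subgraphs G k -> #|J| = (#|predC1 root| + k)%N.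
Proof.
rewrite inE => /asboolP[_ [[_ conn] [z zB]]].
have [f f_inj defJ] := imset_enumeration (erefl #|J|).
rewrite defJ in conn zB.
have [T T_path] := path_family_exists (conn root).
have [N [WN NW]] := path_cycle_unimodular f_inj T_path zB.
by apply/eqP; rewrite eqn_leq (mulmx1_min WN) (mulmx1_min NW).
Qed.

Theorem theorem8p1 (R : realType) (b : scalar_kind) (G : graph)
    (G_connected : is_connected [set: edge G])
    (x : edge G -> R)
    (x_gt0 : forall e, 0 < x e)
    (x_einv : forall e, x (einv e) = x e)
    (k : nat)
    (H : {vspace Omega1 R b G})
    (im_d_sub : (limg (linfun (@differential R b G)) <= H)%VS)
    (dim_H : \dim H = (#|vertex G| - 1 + k)%N)
    (theta : k.-tuple (Omega1 R b G))
    (H_sum : H = (limg (linfun (@differential R b G)) + <<theta>>)%VS)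
    (H_direct : directv (limg (linfun (@differential R b G)) + <<theta>>))
    (Z : {set edge G} -> k.-tuple (chain G))
    (Z_basis : forall K, K \in connected_subgraphs G k -> is_Z1_basis K (Z K))
    (d : measure_display) (T : measurableType d) (P : probability T R)
    (X : T -> {set pos_edge G})
    (X_det : is_determinantal (@form_dot R b G x) P
               (@orthonormal_basis R b G x) H X) :
  {ae P, forall w, subgraph_of (X w) \in connected_subgraphs G k} /\
  forall K, K \in connected_subgraphs G k ->
    P [set w | subgraph_of (X w) = K]%classic =
    (wedge_pairing_sq theta (Z K) * weight_monomial x K
       / partition_function x theta Z)%:E.
Proof.
have [root _] := card_gt0P G_connected.1.
have X_meas := X_det.1.
have h_basis : basis_of H
    [tuple vertex_theta theta j | j < #|predC1 root| + k].
  rewrite basisEdim H_sum vertex_theta_span -H_sum size_tuple dim_H.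
  by rewrite cardC1 subn1 leqnn.
have [p p_orth lawE] := subset_law_determinantal X_det.
have [law0 [t lawt]] := det_event_kernel x_gt0 p_orth h_basis.
pose F K := wedge_pairing_sq theta (Z K) * weight_monomial x K.
pose law := subset_law P X.
have law_in J : subgraph_of J \in connected_subgraphs G k ->
    of_real b (law J) = t * of_real b (F (subgraph_of J)).
  move=> J_in; have [f f_inj defJ] :=
    imset_enumeration (card_connected_subgraph root J_in).
  rewrite /law lawE (lawt J f f_inj defJ); congr (_ * of_real b _).
  rewrite /F mulrC defJ weight_monomial_subgraph // -defJ; congr (_ * _).
  have zB := Z_basis _ J_in.
  move: J_in; rewrite inE => /asboolP[_ [conn _]]; move: conn zB; rewrite defJ.
  exact: (abs_det_form_minor theta f_inj).
have law_out J : subgraph_of J \notin connected_subgraphs G k -> law J = 0.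
  move=> J_out; apply: (@of_real_inj R b); rewrite /law lawE rmorph0.
  (* A set of the wrong cardinality has probability zero. For the right cardinality, a nonzero minor
     would put the subgraph in [connected_subgraphs G k]. *)
  have [Jr|/law0 //] := eqVneq #|J| (#|predC1 root| + k)%N.
  have [f f_inj defJ] := imset_enumeration Jr.
  rewrite (lawt J f f_inj defJ).
  have [det0|detB] := eqVneq (\det (form_minor theta f)) 0.
    rewrite -/(form_minor theta f) det0.
    have -> : abs_scalar (0 : Defs.scalar R b) ^+ 2 = 0.
      by apply/eqP; rewrite abs_scalar_eq0.
    by rewrite mulr0 rmorph0 mulr0.
  by move: J_out; rewrite defJ (form_minor_connected f_inj detB).
have law_total : \sum_(J | subgraph_of J \in connected_subgraphs G k) law J = 1.
  rewrite -(sum_subset_law P X_meas) big_mkcond /=; apply: eq_bigr => J _.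
  by case: ifPn => // /law_out.
(* Subgraphs correspond bijectively to sets of positive edges, which are the values of [X]. *)
have partitionE : partition_function x theta Z =
    \sum_(J | subgraph_of J \in connected_subgraphs G k) F (subgraph_of J).
  rewrite /partition_function (reindex_onto (@subgraph_of G)
    (fun S => [set a | val a \in S])) /=; last first.
    by move=> S; rewrite inE => /asboolP[/subgraph_of_surj <- _].
  apply: eq_bigl => J; case: (boolP (_ \in _)) => //= _.
  by apply/eqP/subgraph_of_inj; rewrite -subgraph_of_surj //;
    exact: is_subgraph_subgraph_of.
(* The total mass 1, carried by the sets in [law_in], fixes the constant [t] and shows at the same
   time that the partition function is not zero. *)
have t_partition : t * of_real b (partition_function x theta Z) = 1.
  rewrite partitionE rmorph_sum mulr_sumr -(rmorph1 (@of_real R b)) -law_total.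
  by rewrite rmorph_sum; apply: eq_bigr => J J_in /=; rewrite law_in.
have partition_neq0 : partition_function x theta Z != 0.
  by apply: contra_eq_neq t_partition => ->;
    rewrite rmorph0 mulr0 eq_sym oner_eq0.
split.
  exists [set w | subgraph_of (X w) \notin connected_subgraphs G k]%classic.
  split=> [||w /= /negP //].
    have -> : [set w | subgraph_of (X w) \notin connected_subgraphs G
      k]%classic =
      (\bigcup_(J in [set` fun J => subgraph_of J \notin connected_subgraphs
        G k])
         [set w | X w = J])%classic.
      apply/seteqP; split=> w /=; first by move=> Qw; exists (X w).
      by move=> [J /= QJ XJ]; rewrite XJ.
    by apply: fin_bigcup_measurable => // J _; exact: X_meas.
  rewrite (probability_pred P X_meas
    (fun J => subgraph_of J \notin connected_subgraphs G k)).
  by rewrite big1 // => J /law_out.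
move=> K K_in; have := K_in; rewrite inE => /asboolP[sK _].
have defK := subgraph_of_surj sK; set J := [set a | _] in defK.
have -> : [set w | subgraph_of (X w) = K]%classic = [set w | X w == J]%classic.
  apply/seteqP; split=> w /=; last by move=> /eqP ->.
  by move=> XK; apply/eqP/subgraph_of_inj; rewrite XK.
rewrite (probability_pred P X_meas (pred1 J)) big_pred1_eq; congr (_%:E).
apply: (canRL (mulfK partition_neq0)); apply: (@of_real_inj R b).
rewrite rmorphM /= -/law law_in -?defK // -/(F K).
by rewrite mulrAC t_partition mul1r.
Qed.
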